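(* Let $t\in[0,1)$ be not a dyadic rational, and let $Q(L)$ be an Orlicz space (generated by a Young function $Q$) such that $$Q(L)\not\subseteq L\log L .$$ Then $$\sup_{A}\left\|\widetilde\sigma_{2^A}^{(t)}\right\|_{Q(L)\to L_1}=\infty ,$$ where the supremum is over $A\in\mathbb N$.
   Context: **Dyadic group.** $G=\prod_{k=0}^{\infty}\{0,1\}$ is the Walsh (dyadic) group of sequences $x=(x_0,x_1,\dots)$, $x_k\in\{0,1\}$, with coordinatewise addition mod 2 and the product measure $\mu$ in which each coordinate takes the values $0,1$ with measure $1/2$ each. $E g=\int_G g\,d\mu$, and $L_1=L_1(G,\mu)$ with $\|g\|_1=E|g|$. **Walsh functions and coefficients.** $r_k(x)=(-1)^{x_k}$. For $k\in\mathbb N=\{0,1,2,\dots\}$ with binary expansion $k=\sum_{i\ge 0}k_i2^i$, $k_i\in\{0,1\}$, put $w_k(x)=\prod_{i\ge 0}r_i(x)^{k_i}$. For $f\in L_1$, $\widehat f(k)=E(fw_k)$. **Dyadic rationals and digits of $t$.** A dyadic rational in $[0,1)$ is a number of the form $p/2^k$ with $p,k\in\mathbb N$, $0\le p<2^k$. For $t\in[0,1)$ write $t=\sum_{j=0}^\infty t_j2^{-(j+1)}$, $t_j\in\{0,1\}$ (for dyadic rational $t$, the expansion terminating in zeros). **Conjugate partial sums and conjugate Fejér means.** Put $\beta_0(t)=(-1)^{t_0}$ and $\beta_k(t)=(-1)^{t_j}$ if $2^{j-1}\le k<2^j$ ($j\ge 1$). For $f\in L_1$, $$\widetilde S_n^{(t)}f=\sum_{k=0}^{n-1}\beta_k(t)\widehat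 f(k)w_k\quad(\widetilde S_0^{(t)}f=0),\qquad \widetilde\sigma_n^{(t)}f=\frac1n\sum_{k=0}^{n-1}\widetilde S_k^{(t)}f\quad(n\ge 1).$$ **Orlicz spaces.** A Young function is a convex continuous even function $Q:\mathbb R\to[0,\infty)$ with $Q(0)=0$, $\lim_{u\to+\infty}Q(u)/u=+\infty$ and $\lim_{u\to0}Q(u)/u=0$. The Orlicz space $Q(L)$ consists of the measurable functions $f$ on $G$ (identified when equal a.e.) with $\|f\|_{Q(L)}<\infty$, where $\|f\|_{Q(L)}=\inf\{k>0: E\,Q(|f|/k)\le 1\}$. Every such $Q(L)$ is contained in $L_1$. $L\log L$ is the Orlicz space generated by $Q(u)=|u|\log(1+|u|)$. **Operator norm.** $\|T\|_{Q(L)\to L_1}=\sup\{E|Tf|: f\in Q(L),\ \|f\|_{Q(L)}\le1\}$. *)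

(* Defs.v *)
From HB Require Import structures.
From mathcomp Require Import all_boot all_order all_algebra.
From mathcomp Require Import all_classical all_reals all_analysis.
From mathcomp Require Import measurable_realfun.

Set Implicit Arguments.
Unset Strict Implicit.
Unset Printing Implicit Defensive.

Import Order.TTheory GRing.Theory Num.Theory.
Import numFieldNormedType.Exports.

Local Open Scope classical_set_scope.
Local Open Scope ring_scope.

Definition coordinate_sets : set (set (nat -> bool)) :=
  [set A | exists (k : nat) (b : bool), A = [set x | x k = b]].

(* The product sigma-algebra on {0,1}^nat. The group law (coordinatewise xor)
   plays no role below. *)
Definition walsh_group := g_sigma_algebraType coordinate_sets.

Definition cylinder (n : nat) (b : nat -> bool) : set walsh_group :=
  [set x | forall i, (i < n)%N -> x i = b i].

(* Cylinders form a pi-system generating the sigma-algebra, so exactly one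
   probability measure satisfies this; existence is [exists_fair_product]. *)
Definition is_fair_product (R : realType) (mu : probability walsh_group R) :=
  forall (n : nat) (b : nat -> bool), mu (cylinder n b) = (2^-1 ^+ n)%:E.

(* For 0 <= t < 1, the j-th digit of the expansion t = \sum_j t_j 2^-(j+1)
   (see [cvg_series_rdigit]), terminating in zeros if t is dyadic. *)
Definition rdigit (R : realType) (t : R) (j : nat) : bool :=
  odd (Num.truncn (2 ^+ j.+1 * t)).

Definition dyadic_rational (R : realType) (t : R) :=
  exists p k : nat, (p < 2 ^ k)%N /\ t = p%:R / 2 ^+ k.

Definition rademacher (R : realType) (k : nat) (x : walsh_group) : R :=
  (-1) ^+ x k.

(* [odd (k %/ 2 ^ i)] is the i-th binary digit of k; it vanishes for i >= k
   since k < 2 ^ k. *)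
Definition walsh (R : realType) (k : nat) (x : walsh_group) : R :=
  \prod_(i < k) rademacher R i x ^+ odd (k %/ 2 ^ i).

(* For k > 0, 2 ^ (j - 1) <= k < 2 ^ j means j = (trunc_log 2 k).+1. *)
Definition beta (R : realType) (t : R) (k : nat) : R :=
  (-1) ^+ rdigit t (if k == 0 then 0 else (trunc_log 2 k).+1).

Section means.
Context (R : realType) (mu : probability walsh_group R).
Implicit Types (f : walsh_group -> R) (t : R).

Definition walsh_coef f (k : nat) : R := \int[mu]_x (f x * walsh R k x).

Definition conj_partial_sum t (n : nat) f : walsh_group -> R :=
  fun x => \sum_(k < n) beta t k * walsh_coef f k * walsh R k x.

Definition conj_fejer t (n : nat) f : walsh_group -> R :=
  fun x => n%:R^-1 * \sum_(k < n) conj_partial_sum t k f x.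

End means.

Record young_function (R : realType) (Q : R -> R) : Prop := YoungFunction {
  young_ge0 : forall u, 0 <= Q u ;
  young_convex : convex_function (E := R^o) [set: R^o] Q ;
  young_continuous : continuous Q ;
  young_even : forall u, Q (- u) = Q u ;
  young_at0 : Q 0 = 0 ;
  young_pinfty : Q u / u @[u --> +oo] --> +oo ;
  young_zero : Q u / u @[u --> 0^'] --> 0 }.

Section orlicz.
Context (R : realType) (mu : probability walsh_group R).
Implicit Types (Q : R -> R) (f : walsh_group -> R).
Local Open Scope ereal_scope.

Definition orlicz_norm Q f : \bar R :=
  ereal_inf [set k%:E | k in
    [set k : R | (0 < k)%R /\ \int[mu]_x (Q (`|f x| / k)%R)%:E <= 1]].

(* Functions rather than classes modulo a.e. equality: membership, the norm and
   the operators above do not depend on the representative. *)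
Definition orlicz_space Q : set (walsh_group -> R) :=
  [set f | measurable_fun [set: walsh_group] f /\ orlicz_norm Q f < +oo].

Definition LlogL : set (walsh_group -> R) :=
  orlicz_space (fun u : R => `|u| * ln (1 + `|u|))%R.

Definition orlicz_L1_opnorm Q (T : (walsh_group -> R) -> walsh_group -> R) :
    \bar R :=
  ereal_sup [set \int[mu]_x `|T f x|%:E | f in
    [set f | orlicz_space Q f /\ orlicz_norm Q f <= 1]].

End orlicz.

Lemma beta_block (R : realType) (t : R) (j k : nat) :
  (2 ^ j <= k < 2 ^ j.+1)%N -> beta t k = (-1) ^+ rdigit t j.+1.
Proof.
move=> jk; rewrite /beta (trunc_log_eq _ jk)//.
by case: k jk => // /andP[]; rewrite leqNgt expn_gt0.
Qed.

Lemma truncn_rdigit (R : realType) (t : R) (n : nat) : 0 <= t ->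
  Num.truncn (2 ^+ n.+1 * t) = ((Num.truncn (2 ^+ n * t)).*2 + rdigit t n)%N.
Proof.
move=> t0; set m := Num.truncn (2 ^+ n.+1 * t).
have h k : 0 <= 2 ^+ k * t by rewrite mulr_ge0// exprn_ge0.
have -> : rdigit t n = odd m by [].
have -> : Num.truncn (2 ^+ n * t) = m./2; last by rewrite addnC odd_double_half.
apply/eqP; rewrite truncn_eq//.
have /andP[m1 m2] := truncn_itv (h n.+1); rewrite -/m in m1 m2.
have e := odd_double_half m.
rewrite exprS -mulrA in m1 m2.
rewrite -(ler_pM2l (ltr0n R 2)) -[X in _ && X](ltr_pM2l (ltr0n R 2)) -!natrM.
apply/andP; split.
  by apply: le_trans m1; rewrite ler_nat mul2n -[leqRHS]e leq_addl.
apply: lt_le_trans m2 _; rewrite ler_nat mul2n doubleS -[X in (X < _)%N]e.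
by case: odd.
Qed.

Lemma truncn_01 (R : realType) (t : R) : 0 <= t < 1 -> Num.truncn t = 0%N.
Proof. by move=> t01; apply/eqP; rewrite truncn_eq; case/andP: t01 => // -> ->. Qed.

Lemma cvg_series_rdigit (R : realType) (t : R) : 0 <= t < 1 ->
  series (fun j => (rdigit t j)%:R * 2^-1 ^+ j.+1) @ \oo --> t.
Proof.
move=> t01; have t0 : 0 <= t by case/andP: t01.
have pow0 n : 0 < 2 ^+ n :> R by rewrite exprn_gt0.
have sumE n : series (fun j => (rdigit t j)%:R * 2^-1 ^+ j.+1 : R) n =
    (Num.truncn (2 ^+ n * t))%:R * 2^-1 ^+ n.
  rewrite /series/=; elim: n => [|n IH].
    by rewrite big_geq// !expr0 mul1r mulr1 truncn_01.
  rewrite big_nat_recr//= IH truncn_rdigit// natrD mulrDl -muln2 natrM exprS.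
  by congr (_ + _); rewrite mulrA mulfK.
have bd n : t - 2^-1 ^+ n <= (Num.truncn (2 ^+ n * t))%:R * 2^-1 ^+ n <= t.
  have /andP[l u] : (Num.truncn (2 ^+ n * t))%:R <= 2 ^+ n * t
      < (Num.truncn (2 ^+ n * t)).+1%:R.
    by rewrite truncn_itv// mulr_ge0// ltW.
  rewrite exprVn ler_pdivrMr// [t * _]mulrC l andbT lerBlDr.
  by rewrite -[X in _ + X]mul1r -mulrDl natr1 ler_pdivlMr// mulrC ltW.
apply: (@squeeze_cvgr _ _ _ _ (fun n => t - 2^-1 ^+ n) (fun=> t)).
- by apply: nearW => n; rewrite sumE.
- rewrite -[X in _ --> X]subr0; apply: cvgB; first exact: cvg_cst.
  by apply: cvg_expr; rewrite ger0_norm ?invr_ge0// invf_lt1// ltr1n.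
- exact: cvg_cst.
Qed.

Lemma rdigit_cylinder (R : realType) (n : nat) (b : nat -> bool) :
  exists2 p, (p < 2 ^ n)%N & forall t : R, 0 <= t < 1 ->
    (forall i, (i < n)%N -> rdigit t i = b i) <-> Num.truncn (2 ^+ n * t) = p.
Proof.
elim: n => [|n [p pn IH]].
  by exists 0%N => // t t01; rewrite expr0 mul1r truncn_01.
exists (p.*2 + b n)%N.
  rewrite expnS mul2n; rewrite -leq_double doubleS in pn.
  by apply: leq_trans pn; case: (b n); rewrite ?addn1 ?addn0.
move=> t t01; rewrite truncn_rdigit; last by case/andP: t01.
split=> [tb|].
  by rewrite tb// (proj1 (IH t t01))// => i /ltnW; exact: tb.
move=> e.
have dn : rdigit t n = b n.
  by move/(congr1 odd): e; rewrite !oddD !odd_double/= !oddb.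
have /(IH t t01) tb : Num.truncn (2 ^+ n * t) = p.
  by move/eqP: e; rewrite dn eqn_add2r => /eqP/double_inj.
by move=> i; rewrite ltnS leq_eqVlt => /predU1P[->//|]; exact: tb.
Qed.

Lemma measurable_rdigit (R : realType) :
  measurable_fun [set: measurableTypeR R] (rdigit (R := R) : R -> walsh_group).
Proof.
apply: (@measurability _ _ _ walsh_group _ _ coordinate_sets) => // _ [_ [k [b ->]] <-]; rewrite setTI.
rewrite (_ : _ @^-1` _ = \bigcup_(m in [set m | odd m = b])
    [set t | Num.truncn (2 ^+ k.+1 * t) = m]); last first.
  apply/seteqP; split=> [t tb|t [m mb tm]].
    by exists (Num.truncn (2 ^+ k.+1 * t)).
  by rewrite /= /rdigit tm.
apply: bigcup_measurable => m _.
have mlt n : measurable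
    ([set t : R | (Num.truncn (2 ^+ k.+1 * t) < n)%N] : set (measurableTypeR R)).
  case: n => [|n]; first by rewrite (_ : mkset _ = set0)//; apply/seteqP; split.
  rewrite (_ : mkset _ = `]-oo, n.+1%:R / 2 ^+ k.+1[%classic); first exact: measurable_itv.
  apply/seteqP; split => t /=;
    by rewrite ltnS truncn_le_nat in_itv/= ltr_pdivlMr ?exprn_gt0// mulrC.
rewrite (_ : mkset _ = [set t : R | (Num.truncn (2 ^+ k.+1 * t) < m.+1)%N] `\`
    [set t | (Num.truncn (2 ^+ k.+1 * t) < m)%N]); first exact: measurableD.
apply/seteqP; split => t /=; first by move=> ->; rewrite ltnn ltnSn.
by move=> [a /negP]; rewrite -leqNgt => b'; apply/eqP; rewrite eqn_leq -ltnS a.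
Qed.

Lemma exists_fair_product (R : realType) :
  exists mu : probability walsh_group R, is_fair_product mu.
Proof.
pose X : {mfun measurableTypeR R >-> walsh_group} := mfun_Sub (mem_set (measurable_rdigit (R := R))).
exists (distribution (uniform_prob (@ltr01 R)) X) => n b.
rewrite /distribution /pushforward /=.
have [p pn pP] := rdigit_cylinder R n b.
set U := _ @^-1` _.
pose I : set R := `[p%:R / 2 ^+ n, p.+1%:R / 2 ^+ n[%classic.
have pow0 : 0 < 2 ^+ n :> R by rewrite exprn_gt0.
have UI t : 0 <= t < 1 -> U t <-> I t.
  move=> t01; have t0 : 0 <= t by case/andP: t01.
  have -> : U t = (forall i, (i < n)%N -> rdigit t i = b i) by [].
  apply: iff_trans (pP t t01) _; rewrite /I/= in_itv/= ler_pdivrMr// ltr_pdivlMr//.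
  rewrite ![t * _]mulrC -truncn_eq ?mulr_ge0 ?(ltW pow0)//.
  by split=> [->|/eqP].
have I01 t : I t -> 0 <= t < 1.
  rewrite /I/= in_itv/= => /andP[l u]; apply/andP; split.
    by apply: le_trans l; rewrite divr_ge0// ltW.
  by apply: lt_le_trans u _; rewrite ler_pdivrMr// mul1r -natrX ler_nat.
have mU : measurable (U : set (measurableTypeR R)).
  rewrite -[U]setTI; apply: (measurable_rdigit (R := R)) => //.
  rewrite (_ : cylinder n b = \bigcap_(i in [set i | (i < n)%N])
      [set x : walsh_group | x i = b i]); last by apply/seteqP; split.
  by apply: bigcap_measurableType => i _; apply: sub_sigma_algebra; exists i, (b i).
have muI : lebesgue_measure I = (2^-1 ^+ n)%:E.
  rewrite /I lebesgue_measure_itv/= lte_fin ltr_pM2r ?invr_gt0// ltr_nat ltnSn.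
  by rewrite -EFinB -mulrBl -natrB// subSnn mul1r exprVn.
rewrite /uniform_prob integral_uniform_pdf (eq_integral (cst 1%E)); last first.
  move=> t; rewrite inE /= => -[_]; rewrite in_itv/= /uniform_pdf => ->.
  by rewrite subr0 invr1.
rewrite integral_cst ?mul1e; last exact: measurableI.
rewrite -muI; apply/eqP; rewrite eq_le; apply/andP; split.
  rewrite -[leRHS]adde0 -(lebesgue_measure_set1 (1 : R)).
  apply: le_trans (measureU2 _ _ _); rewrite ?measurable_itv//; last first.
    exact: measurable_itv.
  apply: le_measure; rewrite ?inE.
  - exact: measurableI.
  - by apply: measurableU => //; exact: measurable_itv.
  - move=> t [Ut]; rewrite /= in_itv/= => /andP[t0].
    by rewrite le_eqVlt => /predU1P[->|t1]; [right|left; apply/UI; rewrite ?t0].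
apply: le_measure; rewrite ?inE; [exact: measurable_itv|exact: measurableI|].
move=> t It; have t01 := I01 t It; split; first exact/UI.
by case/andP: t01 => t0 t1; rewrite /= in_itv/= t0 ltW.
Qed.

(* Main.v *)
Require Import Defs.
From mathcomp Require Import all_boot all_order all_algebra.
From mathcomp Require Import all_classical all_reals all_analysis.
From mathcomp Require Import measurable_realfun.
From mathcomp Require Import ring lra.
Import Order.TTheory GRing.Theory Num.Theory.
Import numFieldNormedType.Exports.
Local Open Scope classical_set_scope.
Local Open Scope ring_scope.

(** If [Q u < eps * u * ln (1 + u)] never happened for large [u], then [Q(L)] would
    be contained in [L log L]; so such [u] exist for every [eps].  Since [t] is not
    dyadic, its digits change infinitely often.  Keep only the coordinates [i] with
    [t_(i+1) <> t_i] and let [f_n] be the Riesz product of the [1 + r_i] over the kept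
    [i < n]; it is [2^N] times the indicator of a set of measure [2^-N], where [N] is
    the number of kept coordinates.  The signs [beta] met by the martingale
    differences [r_i * f_i] alternate, so when a point leaves the support there is no
    cancellation: the transform [T f_n] satisfies
    [2 * |T f_n| >= sum_i f_i * (1 - r_i)], whose integral is [N].  As [f_n] is a Walsh
    polynomial, the means of order [2^A] of [f_n] tend to [T f_n] uniformly.  With
    [2^N] comparable to [Q u], the function [u * 2^-N * f_n] has Orlicz norm at
    most [1], while its transform has [L_1] norm at least
    [u * 2^-N * N / 2 >= 1 / (8 * eps)]. *)

(** * Digit changes of [t] and the Riesz product built on them *)

Section sign_changes.
Set Implicit Arguments.
Unset Strict Implicit.
Context (R : realType) (t : R).
Implicit Types (n : nat) (x : walsh_group).

Definition sign_change n : bool := rdigit t n.+1 != rdigit t n.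

Definition sign_changes n : nat := \sum_(i < n) sign_change i.

Definition riesz_product n x : R :=
  \prod_(i < n) (1 + (sign_change i)%:R * rademacher R i x).

(** The part of the product with frequencies in [[2 ^ i, 2 ^ i.+1)] is [r_i * f_i] if [i] is kept
    and zero otherwise. Since [beta] is constant on that block, this is the image of the product
    under the multiplier [beta]. *)
Definition conj_riesz n x : R := (-1) ^+ rdigit t 0 +
  \sum_(i < n) (-1) ^+ rdigit t i.+1 * (sign_change i)%:R
    * (rademacher R i x * riesz_product i x).

(** A term is non-zero only at the kept coordinate where the point leaves the support, so at most
    one term survives. *)
Definition exit_sum n x : R :=
  \sum_(i < n) (sign_change i)%:R * (1 - rademacher R i x) * riesz_product i x.

Lemma riesz_productS n x : riesz_product n.+1 x =
  (1 + (sign_change n)%:R * rademacher R n x) * riesz_product n x.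
Proof. by rewrite /riesz_product big_ord_recr/= mulrC. Qed.

Lemma riesz_product_two_values n x :
  riesz_product n x = 0 \/ riesz_product n x = 2 ^+ sign_changes n.
Proof.
elim: n => [|n IH]; first by right; rewrite /riesz_product /sign_changes !big_ord0.
rewrite riesz_productS /sign_changes big_ord_recr/= -/(sign_changes n) exprD.
rewrite /rademacher; case: IH => ->; first by left; rewrite mulr0.
by case: (sign_change n); case: (x n); [left|right|right|right]; rewrite /= ?expr0 ?expr1; ring.
Qed.

(* As long as the point stays in the support of the product, the signs used so
   far alternate, so the transform has the sign of the last digit and is
   dominated by the product; on leaving the support, the last term has the same
   sign as the sum of all others. *)
Lemma exit_sum_invariant n x :
  riesz_product n x = 0 /\ exit_sum n x <= 2 * `|conj_riesz n x| \/
  [/\ 0 < riesz_product n x, exit_sum n x = 0 &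
      0 <= (-1) ^+ rdigit t n * conj_riesz n x <= riesz_product n x].
Proof.
elim: n => [|n IH].
  right; rewrite /riesz_product /exit_sum /conj_riesz !big_ord0 addr0 ltr01.
  by rewrite -expr2 sqrr_sign ler01 lexx.
rewrite riesz_productS /exit_sum /conj_riesz !big_ord_recr/=.
rewrite addrA -/(conj_riesz n x) -/(exit_sum n x).
move: (riesz_product n x) (conj_riesz n x) (exit_sum n x) IH => f T H [[-> HT]|].
  by left; rewrite !mulr0 !addr0.
rewrite /sign_change /rademacher => -[f0 -> /andP[T0 Tf]].
case: (rdigit t n) T0 Tf; case: (rdigit t n.+1); case: (x n) => /=;
  rewrite ?expr0 ?expr1 => T0 Tf; try (right; split; [lra|ring|apply/andP; split; lra]).
- left; split; first ring.
  have := ler_norm (-(T + 1 * 1 * (-1 * f))); rewrite normrN; lra.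
- left; split; first ring.
  have := ler_norm (T + -1 * 1 * (-1 * f)); lra.
Qed.

Lemma exit_sum_le_norm n x : exit_sum n x <= 2 * `|conj_riesz n x|.
Proof.
by have [[]//|[_ -> _]] := exit_sum_invariant n x; rewrite mulr_ge0.
Qed.

(** A further digit [b] sends the integer part [p] to [2 * p + b], so [p + b] exactly doubles. *)
Lemma truncn_eventually_constant n (b : bool) : 0 <= t ->
  (forall i, (n <= i)%N -> rdigit t i = b) -> forall m,
  (Num.truncn (2 ^+ (n + m) * t) + b = 2 ^ m * (Num.truncn (2 ^+ n * t) + b))%N.
Proof.
move=> t0 tb; elim=> [|m IH]; first by rewrite addn0 expn0 mul1n.
rewrite addnS truncn_rdigit// tb ?leq_addr// expnS -mulnA -IH.
by rewrite mul2n doubleD -addnA addnn.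
Qed.

Lemma dyadic_of_eventually_constant n : 0 <= t < 1 ->
  (forall i, (n <= i)%N -> rdigit t i = rdigit t n) -> dyadic_rational t.
Proof.
move=> t01 tb; have t0 : 0 <= t by case/andP: t01.
have pow0 k : 0 < 2 ^+ k :> R by rewrite exprn_gt0.
have := truncn_eventually_constant t0 tb.
set b := rdigit t n; set p := Num.truncn (2 ^+ n * t) => E.
have /andP[pl pu] : p%:R <= 2 ^+ n * t < p.+1%:R.
  by rewrite truncn_itv// mulr_ge0// ltW.
(* With [q] the integer part of [2 ^+ (n + m) * t], both this number and [q + b = 2 ^ m * (p + b)]
   lie in [[q, q + 1]]. Dividing by [2 ^ m] gives the bound. *)
have near m : `|2 ^+ n * t - (p + b)%:R| <= 2^-1 ^+ m.
  have /andP[] : (Num.truncn (2 ^+ (n + m) * t))%:R <= 2 ^+ (n + m) * t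
      < (Num.truncn (2 ^+ (n + m) * t)).+1%:R.
    by rewrite truncn_itv// mulr_ge0// ltW.
  have := congr1 (fun k : nat => k%:R : R) (E m).
  rewrite natrD natrM natrX -[X in _ < X]natr1 exprD [_ * 2 ^+ m]mulrC -mulrA.
  move: (Num.truncn _)%:R => q e l u.
  rewrite exprVn -(ler_pM2l (pow0 m)) mulfV ?gt_eqF//.
  rewrite -[X in X * _](gtr0_norm (pow0 m)) -normrM mulrBr -e ler_norml.
  by case: b e {E} => /= e; apply/andP; split; lra.
have e : 2 ^+ n * t = (p + b)%:R.
  apply/eqP; rewrite -subr_eq0 -normr_le0.
  apply: (@cvgr_to_ge nat \oo _ R (fun m => 2^-1 ^+ m)); last exact: nearW.
  by apply: cvg_expr; rewrite ger0_norm ?invr_ge0// invf_lt1// ltr1n.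
have tE : t = (p + b)%:R / 2 ^+ n by rewrite -e mulrC mulKf// gt_eqF.
exists (p + b)%N, n; split=> //.
by case/andP: t01 => _; rewrite {1}tE ltr_pdivrMr// mul1r -natrX ltr_nat.
Qed.

(** Without a change from [n] on, the digits would be constant there and [t] dyadic. The first such
    change raises the count by exactly one, so every value is attained. *)
Lemma unbounded_sign_changes : 0 <= t < 1 -> ~ dyadic_rational t ->
  forall N, exists n, sign_changes n = N.
Proof.
move=> t01 tN; elim=> [|N [n nN]]; first by exists 0%N; rewrite /sign_changes big_ord0.
have [m nm cm] : exists2 m, (n <= m)%N & sign_change m.
  apply: contrapT => h; apply: tN; apply: (dyadic_of_eventually_constant (n := n)) => //.
  move=> i /subnKC <-; elim: (i - n)%N => [|k IH]; rewrite ?addn0// addnS -IH.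
  apply/eqP; apply: contrapT => /negP c; apply: h; exists (n + k)%N => //.
  exact: leq_addr.
have [m' /andP[nm' cm'] minm'] : exists2 m, (n <= m)%N && sign_change m &
    forall k, (n <= k)%N && sign_change k -> (m <= k)%N.
  by case: (@ex_minnP (fun m => (n <= m)%N && sign_change m));
    [exists m; rewrite nm|move=> k kP kmin; exists k].
exists m'.+1; rewrite /sign_changes big_ord_recr/= cm' addn1; congr _.+1.
rewrite -nN /sign_changes -!(big_mkord xpredT (fun i => sign_change i : nat)).
rewrite (big_cat_nat (leq0n n) nm')//= [X in (_ + X)%N]big1_seq ?addn0// => i.
rewrite mem_index_iota => /= /andP[ni im].
case ci: (sign_change i) => //.
by have := minm' i; rewrite ni ci leqNgt im => /(_ isT).
Qed.

End sign_changes.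

(** * Walsh functions and functions of finitely many coordinates *)

Section walsh_analysis.
Set Implicit Arguments.
Unset Strict Implicit.
Context (R : realType) (mu : probability walsh_group R).
Context (mu_product : is_fair_product mu).
Implicit Types (n : nat) (x y : walsh_group) (g : walsh_group -> R).

Lemma sqr_rademacher n x : rademacher R n x * rademacher R n x = 1.
Proof. by rewrite /rademacher -expr2 sqrr_sign. Qed.

(** Digits of [k] from position [n] on vanish; the products of lengths [k] and [n] are compared
    through length [maxn k n]. *)
Lemma walsh_widen k n x : (k < 2 ^ n)%N ->
  walsh R k x = \prod_(i < n) rademacher R i x ^+ odd (k %/ 2 ^ i).
Proof.
move=> kn; have tail m p : (k < 2 ^ m)%N -> (m <= p)%N ->
    \prod_(i < p) rademacher R i x ^+ odd (k %/ 2 ^ i) =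
    \prod_(i < m) rademacher R i x ^+ odd (k %/ 2 ^ i).
  move=> km /subnKC <-; elim: (p - m)%N => [|q IH]; first by rewrite addn0.
  rewrite addnS big_ord_recr/= IH divn_small ?mulr1// (leq_trans km)//.
  by rewrite leq_exp2l// leq_addr.
have kk := ltn_expl k (ltnSn 1).
exact: etrans (esym (tail _ _ kk (leq_maxl k n))) (tail _ _ kn (leq_maxr k n)).
Qed.

Lemma walsh_shift k n x : (k < 2 ^ n)%N ->
  walsh R (2 ^ n + k) x = rademacher R n x * walsh R k x.
Proof.
move=> kn; rewrite (@walsh_widen _ n.+1); last first.
  by rewrite expnS mul2n -addnn ltn_add2l.
rewrite big_ord_recr/= divnDl// divnn expn_gt0/= divn_small// expr1 mulrC.
rewrite (walsh_widen _ kn); congr (_ * _); apply: eq_bigr => i _.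
rewrite divnDl ?dvdn_exp2l 1?ltnW// -expnB 1?ltnW// oddD oddX/=.
by rewrite subn_eq0 leqNgt ltn_ord.
Qed.

Lemma norm_walsh k x : `|walsh R k x| = 1.
Proof.
rewrite normr_prod big1// => i _.
by rewrite normrX /rademacher normrX normrN1 !expr1n.
Qed.

(** An elementary substitute for measurability with respect to the first [n] coordinates: such
    functions are finite combinations of indicators of cylinders. *)
Definition depends_on_first n g :=
  forall x y, (forall i, (i < n)%N -> x i = y i) -> g x = g y.

Lemma depends_on_first_le m n g :
  (m <= n)%N -> depends_on_first m g -> depends_on_first n g.
Proof. by move=> mn gm x y xy; apply: gm => i im; apply: xy; exact: leq_trans mn. Qed.

Lemma depends_rademacher n : depends_on_first n.+1 (rademacher R n).
Proof. by move=> x y xy; rewrite /rademacher xy. Qed.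

Lemma depends_walsh n k : (k < 2 ^ n)%N -> depends_on_first n (walsh R k).
Proof.
move=> kn x y xy; rewrite !(walsh_widen _ kn); apply: eq_bigr => i _.
by rewrite /rademacher xy.
Qed.

Lemma dependsM n g h : depends_on_first n g -> depends_on_first n h ->
  depends_on_first n (fun x => g x * h x).
Proof. by move=> gn hn x y xy; rewrite (gn _ _ xy) (hn _ _ xy). Qed.

Lemma depends_sum n (I : Type) (r : seq I) (P : pred I) (g : I -> walsh_group -> R) :
  (forall i, P i -> depends_on_first n (g i)) ->
  depends_on_first n (fun x => \sum_(i <- r | P i) g i x).
Proof. by move=> gn x y xy; apply: eq_bigr => i Pi; exact: gn. Qed.

(** A point chosen in each cylinder of depth [n]; the tail value [c] serves later to select one of
    its two halves of depth [n.+1]. *)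
Definition extend n (b : {ffun 'I_n -> bool}) (c : bool) : walsh_group :=
  fun i => if insub i is Some j then b j else c.

Lemma measurable_cylinder n b : measurable (cylinder n b).
Proof.
rewrite (_ : cylinder n b = \bigcap_(i in [set i | (i < n)%N])
    [set x : walsh_group | x i = b i]); last by apply/seteqP; split.
by apply: bigcap_measurableType => i _; apply: sub_sigma_algebra; exists i, (b i).
Qed.

Lemma cylinder_extend n b c x :
  cylinder n (extend b c) x <-> b = [ffun i : 'I_n => x i].
Proof.
rewrite /cylinder /extend /=; split=> [xb|-> i ni].
  by apply/ffunP => i; rewrite ffunE xb// valK.
by rewrite insubT ffunE.
Qed.

Lemma depends_decomposition n c g : depends_on_first n g -> forall x,
  g x = \sum_(b : {ffun 'I_n -> bool})
    g (extend b c) * \1_(cylinder n (extend b c)) x.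
Proof.
move=> gn x; rewrite (bigD1 [ffun i : 'I_n => x i])//= big1 ?addr0; last first.
  move=> b /eqP bx; rewrite indicE memNset ?mulr0// => /cylinder_extend//.
have cx := (cylinder_extend [ffun i : 'I_n => x i] c x).2 erefl.
rewrite indicE mem_set// mulr1; exact: gn.
Qed.

Lemma integrable_cylinder n b (k : R) :
  mu.-integrable setT (EFin \o (fun x => k * \1_(cylinder n b) x)).
Proof.
have := integrable_indic mu (measurable_cylinder n b).
exact: (integrableZl measurableT k).
Qed.

Lemma depends_integrable n g :
  depends_on_first n g -> mu.-integrable setT (EFin \o g).
Proof.
move=> gn; rewrite (_ : EFin \o g = fun x => (\sum_(b : {ffun 'I_n -> bool})
    (g (extend b false) * \1_(cylinder n (extend b false)) x)%:E)%E).
  by apply: integrable_sum => // b _; exact: integrable_cylinder.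
by apply/funext => x; rewrite /= {1}(depends_decomposition false gn x) sumEFin.
Qed.

Lemma depends_measurable n g : depends_on_first n g -> measurable_fun setT g.
Proof. by move/depends_integrable/measurable_int/measurable_EFinP. Qed.

(** * Integrals over cylinders and orthogonality of Walsh functions *)

Lemma Rintegral_sum (I : Type) (r : seq I) (P : pred I) (g : I -> walsh_group -> R) :
  (forall i, P i -> mu.-integrable setT (EFin \o g i)) ->
  \int[mu]_x (\sum_(i <- r | P i) g i x) = \sum_(i <- r | P i) \int[mu]_x g i x.
Proof.
move=> gi; elim: r => [|i r IH].
  under eq_Rintegral do rewrite big_nil.
  by rewrite big_nil Rintegral_cst// mul0r.
under eq_Rintegral do rewrite big_cons.
rewrite big_cons; case: ifP => // Pi; rewrite RintegralD ?IH//; first exact: gi.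
rewrite (_ : _ \o _ = fun x => (\sum_(j <- r | P j) (g j x)%:E)%E).
  by apply: integrable_sum => // j; exact: gi.
by apply/funext => x; rewrite /= sumEFin.
Qed.

Lemma Rintegral_cylinder n b (k : R) :
  \int[mu]_x (k * \1_(cylinder n b) x) = k * 2^-1 ^+ n.
Proof.
rewrite RintegralZl//; last first.
  by apply: integrable_indic => //; exact: measurable_cylinder.
rewrite /Rintegral integral_indic ?setIT ?mu_product//; last first.
  exact: measurable_cylinder.
by rewrite [X in fine X]mu_product.
Qed.

(** The two halves of a cylinder of depth [n] have equal measure; [g] has the same value on both,
    and [r_n] opposite signs. *)
Lemma Rintegral_rademacherM n g : depends_on_first n g ->
  \int[mu]_x (rademacher R n x * g x) = 0.
Proof.
move=> gn; have gr : depends_on_first n.+1 (fun x => rademacher R n x * g x).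
  by apply: dependsM (depends_on_first_le (leqnSn n) gn); exact: depends_rademacher.
have e x : rademacher R n x * g x = \sum_(b : {ffun 'I_n -> bool})
    (g (extend b true) * \1_(cylinder n.+1 (extend b false)) x
     - g (extend b true) * \1_(cylinder n.+1 (extend b true)) x).
  rewrite {1}(depends_decomposition true gn x) mulr_sumr; apply: eq_bigr => b _.
  rewrite mulrCA -mulrBr; congr (_ * _).
  have cS c : \1_(cylinder n.+1 (extend b c)) x =
      \1_(cylinder n (extend b true)) x * (x n == c)%:R :> R.
    rewrite !indicE -natrM mulnb; congr (nat_of_bool _)%:R.
    apply/idP/andP => [|[]]; rewrite !inE => h.
      split; last by rewrite h// /extend insubF ?ltnn.
      by move=> i ni; rewrite (h i (leqW ni)) /extend insubT.
    move=> /eqP xc i; rewrite ltnS leq_eqVlt => /predU1P[->|ni].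
      by rewrite xc /extend insubF ?ltnn.
    by rewrite (h i ni) /extend insubT.
  by rewrite !cS /rademacher; case: (x n) => /=; ring.
under eq_Rintegral do rewrite e.
rewrite Rintegral_sum; last first.
  move=> b _; have h c := integrable_cylinder n.+1 (extend b c) (g (extend b true)).
  exact: (integrableB measurableT (h false) (h true)).
apply: big1 => b _; rewrite RintegralB//; try exact: integrable_cylinder.
by rewrite !Rintegral_cylinder subrr.
Qed.

(** By induction on [n]: an index in the upper half contributes a factor [r_n]. Two such factors
    cancel, and a single one makes the integral vanish. *)
Lemma walsh_orthonormal n k l : (k < 2 ^ n)%N -> (l < 2 ^ n)%N ->
  \int[mu]_x (walsh R k x * walsh R l x) = (k == l)%:R.
Proof.
have prob1 : \int[mu]_x (1 : R) = 1.
  by rewrite Rintegral_cst// [X in fine X]probability_setT mulr1.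
elim: n k l => [|n IH] k l.
  rewrite expn0 !ltnS !leqn0 => /eqP -> /eqP ->; rewrite eqxx -prob1.
  by apply: eq_Rintegral => x _; rewrite /walsh !big_ord0 mulr1.
have top m : (m < 2 ^ n.+1)%N -> (2 ^ n <= m)%N ->
    exists2 m', (m' < 2 ^ n)%N & m = (2 ^ n + m')%N.
  move=> mS nm; exists (m - 2 ^ n)%N; last by rewrite subnKC.
  by rewrite ltn_subLR// addnn -mul2n -expnS.
have cross k' l' : (k' < 2 ^ n)%N -> (l' < 2 ^ n)%N ->
    \int[mu]_x (walsh R (2 ^ n + k') x * walsh R l' x) = 0.
  move=> k'n l'n; rewrite -(@Rintegral_rademacherM n (fun x => walsh R k' x * walsh R l' x)).
    by apply: eq_Rintegral => x _; rewrite walsh_shift// mulrA.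
  by apply: dependsM; exact: depends_walsh.
move=> kS lS; have [kn|/(top _ kS)[k' k'n ->]] := ltnP k (2 ^ n);
  have [ln|/(top _ lS)[l' l'n ->]] := ltnP l (2 ^ n).
- exact: IH.
- under eq_Rintegral do rewrite mulrC.
  by rewrite cross// ltn_eqF// (leq_trans kn)// leq_addr.
- by rewrite cross// gtn_eqF// (leq_trans ln)// leq_addr.
rewrite eqn_add2l -IH//; apply: eq_Rintegral => x _.
by rewrite !walsh_shift// mulrACA sqr_rademacher mul1r.
Qed.

Lemma walsh_coef_polynomial n (a : nat -> R) k :
  walsh_coef mu (fun x => \sum_(i < 2 ^ n) a i * walsh R i x) k =
  if (k < 2 ^ n)%N then a k else 0.
Proof.
(* Orthonormality works below one common power of two, which must cover both [k] and the frequencies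
   of the polynomial. *)
have [m [nm km]] : exists m, (n <= m)%N /\ (k < 2 ^ m)%N.
  exists (maxn n k); rewrite leq_maxl; split=> //.
  by rewrite (leq_trans (ltn_expl k (ltnSn 1)))// leq_exp2l// leq_maxr.
have wm i : (i < 2 ^ n)%N -> (i < 2 ^ m)%N.
  by move=> h; rewrite (leq_trans h)// leq_exp2l.
rewrite /walsh_coef; under eq_Rintegral do rewrite mulr_suml.
rewrite Rintegral_sum; last first.
  move=> i _; apply: (@depends_integrable m); apply: dependsM; last exact: depends_walsh.
  by apply: dependsM; [move=> x y _|apply: depends_walsh; exact: wm].
have e (i : 'I_(2 ^ n)) : \int[mu]_x (a i * walsh R i x * walsh R k x) =
    a i * (val i == k)%:R.
  have im := wm i (ltn_ord i).
  under eq_Rintegral do rewrite -mulrA.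
  rewrite RintegralZl//; first by rewrite (walsh_orthonormal im km).
  by apply: (@depends_integrable m); apply: dependsM; exact: depends_walsh.
under eq_bigr do rewrite e.
case: ifPn => [kn|]; last rewrite -leqNgt => nk.
  rewrite (bigD1 (Ordinal kn))//= eqxx mulr1 big1 ?addr0// => i.
  by rewrite -val_eqE => /negbTE/= ->; rewrite mulr0.
by apply: big1 => i _; rewrite ltn_eqF ?mulr0// (leq_trans (ltn_ord i)).
Qed.

(** * Convergence of the conjugate means of Walsh polynomials *)

Lemma conj_partial_sum_stable t f N m x : (N <= m)%N ->
  (forall k, (N <= k)%N -> walsh_coef mu f k = 0) ->
  conj_partial_sum mu t m f x = conj_partial_sum mu t N f x.
Proof.
move=> /subnKC <- fN; rewrite /conj_partial_sum big_split_ord/=.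
by rewrite [X in _ + X]big1 ?addr0// => i _; rewrite fN ?leq_addr// mulr0 mul0r.
Qed.

Lemma conj_partial_sum_bounded t f m :
  exists C : R, forall x, `|conj_partial_sum mu t m f x| <= C.
Proof.
exists (\sum_(k < m) `|beta t k * walsh_coef mu f k|) => x.
apply: le_trans (ler_norm_sum _ _ _) _; apply: ler_sum => k _.
by rewrite normrM norm_walsh mulr1.
Qed.

(** The partial sums are constant from order [N] on, so at most the first [N] terms of the average
    contribute to the error, each uniformly bounded. *)
Lemma conj_fejer_error t f N :
  (forall k, (N <= k)%N -> walsh_coef mu f k = 0) ->
  exists D : R, forall m x, (0 < m)%N ->
    `|conj_fejer mu t m f x - conj_partial_sum mu t N f x| <= D / m%:R.
Proof.
move=> fN; have /choice[C CP] := conj_partial_sum_bounded t f.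
exists (\sum_(j < N) (C j + C N)) => m x m0.
have m0' : m%:R != 0 :> R by rewrite pnatr_eq0 -lt0n.
have -> : conj_fejer mu t m f x - conj_partial_sum mu t N f x =
    m%:R^-1 * \sum_(j < m) (conj_partial_sum mu t j f x - conj_partial_sum mu t N f x).
  by rewrite sumrB sumr_const card_ord mulrBr -[X in _ = _ - _ * X]mulr_natl mulKf.
rewrite normrM ger0_norm ?invr_ge0// mulrC ler_wpM2r ?invr_ge0//.
apply: le_trans (ler_norm_sum _ _ _) _.
have C0 j : 0 <= C j by apply: le_trans (normr_ge0 _) (CP j x).
have bd j : `|conj_partial_sum mu t j f x - conj_partial_sum mu t N f x| <= C j + C N.
  by apply: le_trans (ler_normB _ _) _; exact: lerD.
rewrite -(big_mkord xpredT (fun j => `|conj_partial_sum mu t j f x - conj_partial_sum mu t N f x|)).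
rewrite -(big_mkord xpredT (fun j => C j + C N)).
have [mN|Nm] := leqP m N.
  rewrite [leRHS](big_cat_nat (leq0n m) mN)/= -[leLHS]addr0.
  by apply: lerD; [apply: ler_sum => j _|apply: sumr_ge0 => j _; rewrite addr_ge0].
rewrite (big_cat_nat (leq0n N) (ltnW Nm))/= [X in _ + X]big1_seq ?addr0.
  by apply: ler_sum => j _.
move=> j /=; rewrite mem_index_iota => /andP[Nj _].
by rewrite (conj_partial_sum_stable _ _ Nj fN) subrr normr0.
Qed.

End walsh_analysis.

(** * Conjugate means of the Riesz product *)

Section riesz_transform.
Set Implicit Arguments.
Unset Strict Implicit.
Context (R : realType) (mu : probability walsh_group R).
Context (mu_product : is_fair_product mu).
Variable t : R.
Implicit Types (n : nat) (x : walsh_group).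

Lemma depends_riesz_product n : depends_on_first n (riesz_product t n).
Proof.
by move=> x y xy; apply: eq_bigr => i _; rewrite /rademacher xy.
Qed.

Lemma Rintegral_riesz_product n : \int[mu]_x riesz_product t n x = 1.
Proof.
elim: n => [|n IH].
  under eq_Rintegral do rewrite /riesz_product big_ord0.
  by rewrite Rintegral_cst// [X in fine X]probability_setT mulr1.
have fn := depends_integrable mu (@depends_riesz_product n).
have rf := dependsM (@depends_rademacher R n)
  (depends_on_first_le (leqnSn n) (@depends_riesz_product n)).
under eq_Rintegral do rewrite riesz_productS mulrDl mul1r -mulrA.
rewrite RintegralD//; last first.
  apply: (@depends_integrable _ mu n.+1); apply: dependsM rf.
  by move=> x y.
rewrite RintegralZl//; last exact: depends_integrable rf.
by rewrite IH (Rintegral_rademacherM mu_product (@depends_riesz_product n)) mulr0 addr0.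
Qed.

Lemma depends_exit_sum n : depends_on_first n (exit_sum t n).
Proof.
apply: depends_sum => i _ x y xy.
rewrite /rademacher xy//; congr (_ * _); apply: depends_riesz_product => j ji.
by apply: xy; exact: ltn_trans ji _.
Qed.

(** As [f_i] has mean one and [r_i * f_i] mean zero, each kept coordinate contributes one. *)
Lemma Rintegral_exit_sum n : \int[mu]_x exit_sum t n x = (sign_changes t n)%:R.
Proof.
have di (i : nat) := @depends_riesz_product i.
have ri i := dependsM (@depends_rademacher R i) (depends_on_first_le (leqnSn i) (di i)).
have fi i := depends_integrable mu (di i).
have rfi i := depends_integrable mu (ri i).
rewrite /exit_sum Rintegral_sum; last first.
  move=> i _; apply: (@depends_integrable _ mu i.+1); apply: dependsM.
    by move=> x y xy; rewrite /rademacher xy.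
  exact: depends_on_first_le (di i).
rewrite /sign_changes natr_sum; apply: eq_bigr => i _.
under eq_Rintegral do rewrite -mulrA mulrBl mul1r.
rewrite RintegralZl//; last exact: (integrableB measurableT (fi i) (rfi i)).
rewrite RintegralB// Rintegral_riesz_product (Rintegral_rademacherM mu_product (di i)).
by rewrite subr0 mulr1.
Qed.

(** For a kept [n], the factor [1 + r_n] copies the coefficients below [2 ^ n] to the next block,
    where [beta] has the single value [(-1) ^+ rdigit t n.+1]; otherwise that block gets zeros. *)
Lemma riesz_product_walsh n : exists a : nat -> R, forall x,
  riesz_product t n x = \sum_(k < 2 ^ n) a k * walsh R k x /\
  conj_riesz t n x = \sum_(k < 2 ^ n) beta t k * a k * walsh R k x.
Proof.
elim: n => [|n [a aP]].
  exists (fun=> 1) => x; rewrite /riesz_product /conj_riesz expn0.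
  by rewrite !big_ord0 !big_ord1 addr0 /beta /walsh big_ord0 !mulr1.
exists (fun k => if (k < 2 ^ n)%N then a k
  else (sign_change t n)%:R * a (k - 2 ^ n)%N) => x.
have [fE TE] := aP x; rewrite expnS mul2n -addnn !big_split_ord/=.
have -> : \sum_(k < 2 ^ n) (if (k < 2 ^ n)%N then a k
      else (sign_change t n)%:R * a (k - 2 ^ n)%N) * walsh R k x =
    riesz_product t n x.
  by rewrite fE; apply: eq_bigr => k _; rewrite ltn_ord.
have -> : \sum_(k < 2 ^ n) beta t k * (if (k < 2 ^ n)%N then a k
      else (sign_change t n)%:R * a (k - 2 ^ n)%N) * walsh R k x =
    conj_riesz t n x.
  by rewrite TE; apply: eq_bigr => k _; rewrite ltn_ord.
split.
  rewrite riesz_productS mulrDl mul1r; congr (_ + _).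
  rewrite fE mulr_sumr; apply: eq_bigr => k _.
  by rewrite ltnNge leq_addr/= addKn walsh_shift//; ring.
rewrite /conj_riesz big_ord_recr/= addrA -/(conj_riesz t n x); congr (_ + _).
rewrite fE !mulr_sumr; apply: eq_bigr => k _.
rewrite ltnNge leq_addr/= addKn walsh_shift// (@beta_block _ t n); first ring.
by rewrite leq_addr expnS mul2n -addnn ltn_add2l ltn_ord.
Qed.

Lemma conj_partial_sum_riesz n (c : R) :
  (forall k, (2 ^ n <= k)%N ->
     walsh_coef mu (fun x => c * riesz_product t n x) k = 0) /\
  forall x, conj_partial_sum mu t (2 ^ n) (fun x => c * riesz_product t n x) x =
    c * conj_riesz t n x.
Proof.
have [a aP] := riesz_product_walsh n.
have -> : (fun x => c * riesz_product t n x) =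
    (fun x => \sum_(k < 2 ^ n) (c * a k) * walsh R k x).
  apply/funext => x; rewrite (aP x).1 mulr_sumr.
  by apply: eq_bigr => k _; rewrite mulrA.
split=> [k nk|x].
  by rewrite (walsh_coef_polynomial mu_product n (fun k => c * a k)) ltnNge nk.
rewrite (aP x).2 mulr_sumr; apply: eq_bigr => k _.
rewrite (walsh_coef_polynomial mu_product n (fun k => c * a k)) ltn_ord; ring.
Qed.

Lemma depends_conj_fejer n A f : (n <= 2 ^ A)%N ->
  depends_on_first A (conj_fejer mu t n f).
Proof.
move=> nA; apply: dependsM; first by move=> x y.
apply: depends_sum => i _; apply: depends_sum => k _.
apply: dependsM; first by move=> x y.
apply: depends_walsh; apply: leq_trans nA.
exact: ltn_trans (ltn_ord k) (ltn_ord i).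
Qed.

(** The lower bound for the transform by [exit_sum] is integrated; the subtracted 1 absorbs the
    uniform distance from the mean to the transform. *)
Lemma conj_fejer_riesz_lower n (c : R) : 0 <= c -> exists A : nat,
  ((c * (sign_changes t n)%:R / 2 - 1)%:E <=
    \int[mu]_x `|conj_fejer mu t (2 ^ A) (fun x => c * riesz_product t n x) x|%:E)%E.
Proof.
move=> c0; have [f0 fS] := conj_partial_sum_riesz n c.
have [D DP] := conj_fejer_error t f0.
have [A DA] : exists A : nat, D <= 2 ^+ A.
  have [D0|D0] := leP 0 D; last by exists 0%N; rewrite (le_trans (ltW D0)).
  exists (Num.bound D); apply: le_trans (ltW (archi_boundP D0)) _.
  by rewrite -natrX ler_nat ltnW// ltn_expl.
exists A; set g := conj_fejer _ _ _ _.
have dg : depends_on_first A (fun x => `|g x|).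
  by move=> x y xy; congr `|_|; apply: depends_conj_fejer xy.
have ig := depends_integrable mu dg.
have iE := depends_integrable mu (@depends_exit_sum n).
have icE : mu.-integrable setT (EFin \o (fun x => c / 2 * exit_sum t n x)).
  exact: (integrableZl measurableT (c / 2) iE).
have i1 := finite_measure_integrable_cst mu (1 : R) (@measurableT _ walsh_group).
rewrite -[leRHS]fineK; last exact: integrable_fin_num.
rewrite lee_fin -/(Rintegral mu setT (fun x => `|g x|)).
have -> : c * (sign_changes t n)%:R / 2 - 1 = \int[mu]_x (c / 2 * exit_sum t n x - 1).
  rewrite RintegralB// RintegralZl// Rintegral_exit_sum Rintegral_cst//.
  by rewrite [X in fine X]probability_setT mulr1 mulrAC.
apply: le_Rintegral => //; first exact: (integrableB measurableT icE i1).
move=> x _.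
have m0 : (0 < 2 ^ A)%N by rewrite expn_gt0.
have := DP _ x m0; rewrite -/g fS => gD.
have D1 : D / (2 ^ A)%:R <= 1 by rewrite natrX ler_pdivrMr ?mul1r// exprn_gt0.
have := ler_wpM2l c0 (exit_sum_le_norm t n x).
have := ler_distD (g x) (c * conj_riesz t n x) 0.
rewrite !subr0 normrM (ger0_norm c0) distrC.
have := gD; lra.
Qed.

End riesz_transform.

(** * Growth of Young functions and comparison with [L log L] *)

Section young_functions.
Set Implicit Arguments.
Unset Strict Implicit.
Context (R : realType) (mu : probability walsh_group R).
Implicit Types (Q : R -> R) (u : R).

Lemma orlicz_norm_le Q (f : walsh_group -> R) (k : R) : 0 < k ->
  (\int[mu]_x (Q (`|f x| / k))%:E <= 1)%E -> (orlicz_norm mu Q f <= k%:E)%E.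
Proof. by move=> k0 Qk; apply: ereal_inf_lbound; exists k. Qed.

Lemma measurable_LlogL_young :
  measurable_fun setT (fun u : R => `|u| * ln (1 + `|u|)).
Proof.
apply: measurable_funM; first exact: normr_measurable.
apply: measurableT_comp => //; apply: measurable_funD => //.
Qed.

Lemma ge0_ln1D_mono u v : 0 <= u -> u <= v -> u * ln (1 + u) <= v * ln (1 + v).
Proof.
move=> u0 uv; have v0 := le_trans u0 uv.
apply: ler_pM => //; first by rewrite ln_ge0// lerDl.
by rewrite ler_ln ?posrE ?ltr_wpDr ?lerD2l.
Qed.

(** By contraposition: if [Q] dominates [eps * u * ln (1 + u)] beyond some [U], then
    [u * ln (1 + u)] is at most a constant plus [Q u / eps], which yields the inclusion. *)
Lemma young_not_dominating Q : young_function Q ->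
  ~ (orlicz_space mu Q `<=` LlogL mu) ->
  forall eps U, 0 < eps -> exists2 u, U <= u & Q u < eps * (u * ln (1 + u)).
Proof.
move=> QY; apply: contra_notP => /existsNP[eps /existsNP[U']].
move=> /not_implyP[eps0 noU].
pose U := Num.max U' 0; have U0 : 0 <= U by rewrite le_max lexx orbT.
have QU u : U <= u -> eps * (u * ln (1 + u)) <= Q u.
  rewrite ge_max => /andP[Uu _]; rewrite leNgt; apply/negP => h.
  by apply: noU; exists u.
move=> f [mf /ereal_inf_lt[_ [k [k0 Qk] <-] _]]; split=> //.
pose B := U * ln (1 + U).
have B0 : 0 <= B by rewrite mulr_ge0// ln_ge0// lerDl.
(* The norm is tested at [k * C]: [C >= 1] only decreases the logarithm, and [B + eps^-1 <= C]
   brings the integral below one. *)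
pose C := 1 + B + eps^-1; have C1 : 1 <= C by rewrite /C -addrA lerDl addr_ge0// invr_ge0 ltW.
have C0 : 0 < C := lt_le_trans ltr01 C1.
have Ci0 : 0 <= C^-1 by rewrite invr_ge0 ltW.
have epsi0 : 0 <= eps^-1 by rewrite invr_ge0 ltW.
have kC0 : 0 < k * C by rewrite mulr_gt0.
apply: (@le_lt_trans _ _ (k * C)%:E); last exact: ltry.
apply: orlicz_norm_le => //.
pose h x := Q (`|f x| / k).
have h0 x : 0 <= h x by exact: young_ge0.
have mnf : measurable_fun setT (fun x => `|f x|).
  exact: (measurableT_comp (@normr_measurable R setT) mf).
have mh : measurable_fun setT h.
  apply: (measurableT_comp (continuous_measurable_fun (young_continuous QY))).
  exact: measurable_funM.
have bound x : `| `|f x| / (k * C)| * ln (1 + `| `|f x| / (k * C)|) <=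
    C^-1 * (B + eps^-1 * h x).
  have -> : `|f x| / (k * C) = C^-1 * (`|f x| / k) by rewrite invfM mulrA mulrC.
  rewrite /h; set v := `|f x| / k; have v0 : 0 <= v by rewrite divr_ge0// ltW.
  have w0 : 0 <= C^-1 * v by rewrite mulr_ge0.
  rewrite (ger0_norm w0) -mulrA ler_wpM2l//.
  apply: (@le_trans _ _ (v * ln (1 + v))).
    rewrite ler_wpM2l// ler_ln ?posrE ?ltr_wpDr//.
    by rewrite lerD2l ler_piMl// invf_le1.
  have [vU|Uv] := leP v U.
    apply: ler_wpDr; [exact: mulr_ge0 epsi0 (h0 x)|exact: ge0_ln1D_mono].
  by rewrite ler_wpDl// -(ler_pM2l eps0) mulVKf ?gt_eqF// QU// ltW.
apply: (@le_trans _ _ (\int[mu]_x ((C^-1 * B)%:E + (C^-1 * eps^-1)%:E * (h x)%:E)))%E.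
  apply: ge0_le_integral => //.
  - by move=> x _; rewrite lee_fin mulr_ge0// ln_ge0// lerDl.
  - apply/measurable_EFinP; apply: (measurableT_comp measurable_LlogL_young).
    exact: measurable_funM.
  - apply: emeasurable_funD => //; apply: measurable_funeM; exact/measurable_EFinP.
  - move=> x _; rewrite -EFinM -EFinD lee_fin; apply: le_trans (bound x) _.
    by rewrite mulrDr mulrA.
rewrite ge0_integralD//; last 3 first.
- by move=> x _; rewrite lee_fin mulr_ge0.
- by move=> x _; rewrite -EFinM lee_fin !mulr_ge0.
- by apply: measurable_funeM; exact/measurable_EFinP.
rewrite ge0_integralZl//; last 3 first.
- exact/measurable_EFinP.
- by move=> x _; rewrite lee_fin.
- by rewrite lee_fin mulr_ge0.
rewrite integral_cst// [X in (_ * X + _)%E]probability_setT mule1.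
apply: (@le_trans _ _ ((C^-1 * B)%:E + (C^-1 * eps^-1)%:E * 1))%E.
  rewrite leeD2l// lee_wpmul2l// lee_fin mulr_ge0//.
rewrite mule1 -EFinD lee_fin -mulrDr -(ler_pM2l C0) mulVKf ?gt_eqF// mulr1.
by rewrite /C -addrA lerDr.
Qed.

(** Serves to bound [u], and so [ln (1 + u)], by means of a power of two above [Q u]. *)
Lemma young_superlinear Q : young_function Q ->
  exists U, forall u, U <= u -> u <= Q u.
Proof.
move=> QY; have /cvgryPge/(_ 1)[M [_ MQ]] := young_pinfty QY.
exists (Num.max M 0 + 1) => u uM.
have uM' : Num.max M 0 < u by apply: lt_le_trans uM; rewrite ltrDl.
move: uM'; rewrite gt_max => /andP[Mu u0].
by have := MQ u Mu; rewrite ler_pdivlMr// mul1r.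
Qed.

End young_functions.

(** * Choice of the parameters and conclusion *)

Lemma dyadic_upper_bound (R : realType) (x : R) : 1 < x ->
  exists2 N : nat, (0 < N)%N & x <= 2 ^+ N <= 2 * x.
Proof.
move=> x1; have [N xN minN] : exists2 N : nat, x <= 2 ^+ N &
    forall n : nat, x <= 2 ^+ n -> (N <= n)%N.
  have x0 : 0 <= x by apply: ltW; exact: lt_trans x1.
  have ex : exists n : nat, x <= 2 ^+ n.
    exists (Num.bound x); apply: le_trans (ltW (archi_boundP x0)) _.
    by rewrite -natrX ler_nat ltnW// ltn_expl.
  by case: (ex_minnP ex) => N xN minN; exists N.
have N0 : (0 < N)%N.
  by case: N xN {minN} => // ; rewrite expr0 leNgt x1.
(* By minimality of [N], the previous power [2 ^+ N.-1] is below [x]. *)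
exists N => //; rewrite xN/= -(prednK N0) exprS ler_pM2l// leNgt.
by apply/negP => /ltW /minN; rewrite -ltnS (prednK N0) ltnn.
Qed.

Theorem theorem3 (R : realType) (mu : probability walsh_group R)
  (mu_product : is_fair_product mu)
  (t : R) (t01 : 0 <= t < 1) (t_not_dyadic : ~ dyadic_rational t)
  (Q : R -> R) (Q_young : young_function Q)
  (Q_not_sub : ~ (orlicz_space mu Q `<=` LlogL mu)) :
  ereal_sup [set orlicz_L1_opnorm mu Q (conj_fejer mu t (2 ^ A)) | A in [set: nat]]
    = +oo%E.
Proof.
apply/eqyP => M M0.
(* Makes [1 / (8 * eps)] equal to [M + 1], leaving [M] after the loss of 1 in the lower bound. *)
pose eps : R := (8 * (M + 1))^-1.
have M1 : 0 < M + 1 by rewrite addr_gt0.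
have eps0 : 0 < eps by rewrite invr_gt0 mulr_gt0.
have [U UQ] := young_superlinear Q_young.
(* The threshold 2 forces [Q u > 1], hence [N > 0]. *)
have [u] := young_not_dominating Q_young Q_not_sub (Num.max U 2) eps0.
rewrite ge_max => /andP[Uu u2] Qu.
have uQ := UQ u Uu; have u0 : 0 < u by apply: lt_le_trans u2.
have Q1 : 1 < Q u by apply: lt_le_trans uQ; apply: lt_le_trans u2; rewrite ltr1n.
have [N N0 /andP[QN NQ]] := dyadic_upper_bound Q1.
have [n nN] := unbounded_sign_changes t01 t_not_dyadic N.
have pN : 0 < 2 ^+ N :> R by rewrite exprn_gt0.
(* With this scaling [f] takes only the values 0 and [u], so [Q] of it is again a multiple of the
   Riesz product, with integral [Q u / 2 ^+ N <= 1]. *)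
pose c := u / 2 ^+ N; have c0 : 0 <= c by rewrite divr_ge0// ltW.
pose f : walsh_group -> R := fun x => c * riesz_product t n x.
have df : depends_on_first n f.
  by apply: dependsM; [move=> x y|exact: depends_riesz_product].
have QfE x : Q (`|f x| / 1) = Q u / 2 ^+ N * riesz_product t n x.
  rewrite divr1 /f; have [->|->] := riesz_product_two_values t n x.
    by rewrite !mulr0 normr0 young_at0.
  by rewrite nN /c divfK ?gt_eqF// divfK ?gt_eqF// ger0_norm// ltW.
have fQ : (orlicz_norm mu Q f <= 1)%E.
  apply: orlicz_norm_le => //; under eq_integral do rewrite QfE.
  have dQ : depends_on_first n (fun x => Q u / 2 ^+ N * riesz_product t n x).
    by apply: dependsM; [move=> x y|exact: depends_riesz_product].
  rewrite -[leLHS]fineK; last exact: integrable_fin_num (depends_integrable mu dQ).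
  rewrite lee_fin -/(Rintegral mu setT (fun x => Q u / 2 ^+ N * riesz_product t n x)).
  rewrite RintegralZl//; last exact: depends_integrable (@depends_riesz_product _ t n).
  by rewrite Rintegral_riesz_product// mulr1 ler_pdivrMr// mul1r.
have [A AP] := conj_fejer_riesz_lower mu_product t n c0.
apply: (@le_trans _ _ (orlicz_L1_opnorm mu Q (conj_fejer mu t (2 ^ A)))); last first.
  by apply: ereal_sup_ubound; exists A.
apply: (@le_trans _ _ (\int[mu]_x `|conj_fejer mu t (2 ^ A) f x|%:E)%E); last first.
  apply: ereal_sup_ubound; exists f => //; split=> //; split.
    exact (depends_measurable mu df).
  by apply: le_lt_trans fQ _; exact: ltry.
apply: le_trans AP; rewrite lee_fin nN.
(* From [u <= Q u <= 2 ^+ N] follows [1 + u <= 2 ^+ N.+1]; then [ln 2 <= 1] and [N.+1 <= 2 * N]. *)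
have lnu : ln (1 + u) <= 2 * N%:R.
  have h1 : 1 + u <= 2 ^+ N.+1.
    have : 1 <= 2 ^+ N :> R by rewrite exprn_ege1// ler1n.
    rewrite exprS; lra.
  apply: (@le_trans _ _ (ln (2 ^+ N.+1))).
    by rewrite ler_ln ?posrE ?exprn_gt0// addr_gt0.
  rewrite lnXn// -[leLHS]mulr_natr.
  have l2 : ln 2 <= 1 :> R by have := @le_ln1Dx R 1; rewrite -natr1 addrC; apply; lra.
  apply: (@le_trans _ _ (1 * N.+1%:R)); first by rewrite ler_wpM2r.
  by rewrite mul1r mulr_natl -mulrnA ler_nat muln2 -addnn -addn1 leq_add2l.
(* Chains [2 ^+ N <= 2 * Q u], the smallness of [Q u], and the bound on the logarithm. *)
have key : 2 ^+ N <= 4 * eps * u * N%:R.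
  apply: le_trans NQ _.
  have : eps * (u * ln (1 + u)) <= eps * (u * (2 * N%:R)).
    by rewrite !ler_wpM2l// ltW.
  move: Qu; lra.
have e1 : 8 * (M + 1) * eps = 1 by rewrite /eps divff// gt_eqF// mulr_gt0.
rewrite lerBrDr /c ler_pdivlMr// mulrAC ler_pdivlMr//.
have M2 : 0 <= 2 * (M + 1) by rewrite mulr_ge0// ltW.
have := ler_wpM2l M2 key.
have -> : 2 * (M + 1) * (4 * eps * u * N%:R) = u * N%:R * (8 * (M + 1) * eps) by ring.
rewrite e1; lra.
Qed.
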